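(* Let $\mathbf{M}$ be a finite structure, define $\mathcal{A}:=\mathsf{ISP}(\mathbf{M})$ and assume that the associated topological prevariety $\mathcal{A}_{\mathscr{T}}:=\mathsf{IS}_{\mathrm c}\mathsf{P}(\mathbf{M}_{\mathscr{T}})$ is standard. Then, for every $\mathbf{A}\in\mathcal{A}$, the zero-dimensional Bohr compactification $b_0(\mathbf{A})$ of the structure $\mathbf{A}$ coincides with its natural extension $n_{\mathcal{A}}(\mathbf{A})$.
   Context: A structure $\mathbf{A}=\langle A;G,H,R\rangle$ is a set $A$ with a set $G$ of finitary total operations, a set $H$ of finitary partial operations and a set $R$ of finitary relations. Products are formed coordinatewise (a partial operation is defined at a tuple iff it is defined in every coordinate); a substructure is a subset closed under the operations and under the partial operations where defined, with restricted structure; homomorphisms preserve operations, relations and partial operations (where defined); embeddings are isomorphisms onto substructures. A topological structure is a structure with a topology such that the relations and the domains of partial operations are topologically closed and the operations and partial operations are continuous. All compact spaces are assumed Hausdorff. $\mathbf{M}_{\mathscr{T}}$ is $\mathbf{M}$ with the discrete topology. $\mathsf{ISP}(\mathbf{M})$ is the class of isomorphic copies of non-empty substructures of powers of $\mathbf{M}$ (morphisms: homomorphisms); $\mathsf{IS}_{\mathrm c}\mathsf{P}(\mathbf{M}_{\mathscr{T}})$ is the class of isomorphic copies of non-empty topologically closed substructures of powers of $\mathbf{M}_{\mathscr{T}}$ (morphisms: continuous homomorphisms). $\mathbf{B}^\flat$ is $\mathbf{B}$ with its topology forgotten. $\mathcal{A}^{\mathrm{Bt}}$ is the category of compact zero-dimensional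 (i.e. having a basis of clopen sets) topological structures $\mathbf{B}$ with $\mathbf{B}^\flat\in\mathcal{A}$, with continuous homomorphisms. $\mathcal{A}_{\mathscr{T}}$ is standard if $\mathcal{A}_{\mathscr{T}}=\mathcal{A}^{\mathrm{Bt}}$, i.e. $\mathcal{A}_{\mathscr{T}}$ consists precisely of the Boolean-topological structures that are models of the quasi-equations defining $\mathcal{A}$. Natural extension: $n_{\mathcal{A}}(\mathbf{A})$ is the smallest topologically closed substructure of $\mathbf{M}_{\mathscr{T}}^{\mathcal{A}(\mathbf{A},\mathbf{M})}$ containing $e_{\mathbf{A}}(A)$, where $e_{\mathbf{A}}(a)(x):=x(a)$ for $a\in A$ and $x$ in the hom-set $\mathcal{A}(\mathbf{A},\mathbf{M})$. The zero-dimensional Bohr compactification $b_0(\mathbf{A})\in\mathcal{A}^{\mathrm{Bt}}$ comes with an embedding $\iota_{\mathbf{A}}\colon\mathbf{A}\to b_0(\mathbf{A})^\flat$ such that the closed substructure generated by $\iota_{\mathbf{A}}(A)$ is $b_0(\mathbf{A})$, and is characterised up to isomorphism by: for every $\mathbf{B}\in\mathcal{A}^{\mathrm{Bt}}$ and homomorphism $g\colon\mathbf{A}\to\mathbf{B}^\flat$ there is a unique continuous homomorphism $h\colon b_0(\mathbf{A})\to\mathbf{B}$ with $h\circ\iota_{\mathbf{A}}=g$. ''Coincides'' means isomorphic as topological structures via an isomorphism commuting with the embeddings $\iota_{\mathbf{A}}$ and $e_{\mathbf{A}}$. *)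

(* Defs.v *)
From HB Require Import structures.
From mathcomp Require Import all_boot all_classical.
From mathcomp Require Import topology.

Set Implicit Arguments.
Unset Strict Implicit.
Unset Printing Implicit Defensive.

Local Open Scope classical_set_scope.

Record signature := Signature {
  op_sym : Type;   op_ar : op_sym -> nat;
  pop_sym : Type;  pop_ar : pop_sym -> nat;
  rel_sym : Type;  rel_ar : rel_sym -> nat }.

(* A partial operation is a domain together with a total function on that
   domain, seen as a type through the coercion from sets to types. *)
Record interp (S : signature) (T : Type) := Interp {
  op : forall g : op_sym S, ('I_(op_ar g) -> T) -> T;
  pdom : forall h : pop_sym S, set ('I_(pop_ar h) -> T);
  pop : forall h : pop_sym S, @pdom h -> T;
  srel : forall r : rel_sym S, set ('I_(rel_ar r) -> T) }.

Arguments op {S T} _ g _.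
Arguments pdom {S T} _ h.
Arguments pop {S T} _ h _.
Arguments srel {S T} _ r.

Record structure (S : signature) := Structure {
  carrier :> Type;
  structure_interp :> interp S carrier }.

Record finStructure (S : signature) := FinStructure {
  fin_carrier :> finType;
  fin_interp : interp S fin_carrier }.

Definition of_fin (S : signature) (M : finStructure S) : structure S :=
  Structure (fin_interp M).
Coercion of_fin : finStructure >-> structure.

(* A structure whose carrier is a topological space, with no compatibility
   between the two; compatibility is [topological_structure] below. *)
Record spaceStructure (S : signature) := SpaceStructure {
  space :> topologicalType;
  space_interp : interp S space }.

Definition flat (S : signature) (B : spaceStructure S) : structure S :=
  Structure (space_interp B).

Section Morphisms.
Variable S : signature.

Definition hom (A B : structure S) (f : A -> B) : Prop :=
  [/\ forall g (a : 'I_(op_ar g) -> A), f (op A g a) = op B g (f \o a),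
      forall h (a : pdom A h),
        exists2 b : pdom B h, set_val b = f \o set_val a
                            & f (pop A h a) = pop B h b
    & forall r a, srel A r a -> srel B r (f \o a)].

Definition iso (A B : structure S) (f : A -> B) : Prop :=
  hom f /\ exists f' : B -> A, [/\ hom f', cancel f f' & cancel f' f].

Definition top_iso (B C : spaceStructure S) (f : B -> C) : Prop :=
  [/\ @hom (flat B) (flat C) f, continuous f
    & exists f' : C -> B, [/\ @hom (flat C) (flat B) f', continuous f',
                              cancel f f' & cancel f' f]].

End Morphisms.

Section Substructures.
Variables (S : signature) (T : Type) (m : interp S T).

Definition substructure (X : set T) : Prop :=
  (forall g (a : 'I_(op_ar g) -> T), (forall i, X (a i)) -> X (op m g a)) /\
  (forall h (a : pdom m h), (forall i, X (set_val a i)) -> X (pop m h a)).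

Section Restriction.
Variables (X : set T) (subX : substructure X).

Definition restr_op g (a : 'I_(op_ar g) -> X) : X :=
  SigSub (mem_set (subX.1 g (set_val \o a) (fun i => set_valP (a i)))).

Definition restr_pdom h : set ('I_(pop_ar h) -> X) :=
  [set a | pdom m h (set_val \o a)].

Definition restr_pop h (a : @restr_pdom h) : X :=
  let a' : pdom m h :=
    SigSub (mem_set (set_valP a : pdom m h (set_val \o set_val a))) in
  SigSub (mem_set (subX.2 h a' (fun i => set_valP (set_val a i)))).

Definition restr_rel r : set ('I_(rel_ar r) -> X) :=
  [set a | srel m r (set_val \o a)].

Definition restr_interp : interp S X := Interp restr_op restr_pop restr_rel.

End Restriction.
End Substructures.

Definition restr (S : signature) (A : structure S) (X : set A)
    (subX : substructure A X) : structure S :=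
  Structure (restr_interp subX).

Definition space_restr (S : signature) (B : spaceStructure S) (X : set B)
    (subX : substructure (flat B) X) : spaceStructure S :=
  SpaceStructure (restr_interp subX : interp S (set_type X)).

Definition embedding (S : signature) (A B : structure S) (f : A -> B) : Prop :=
  exists (X : set B) (subX : substructure B X) (phi : A -> restr subX),
    iso phi /\ forall a, f a = set_val (phi a).

Section Powers.
Variables (S : signature) (T : Type) (m : interp S T) (I : Type).

Definition pow_op g (a : 'I_(op_ar g) -> I -> T) : I -> T :=
  fun i => op m g (a^~ i).

Definition pow_pdom h : set ('I_(pop_ar h) -> I -> T) :=
  [set a | forall i, pdom m h (a^~ i)].

Definition pow_pop h (a : @pow_pdom h) : I -> T :=
  fun i => pop m h
    (SigSub (mem_set (set_valP a i : pdom m h ((set_val a)^~ i)))).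

Definition pow_rel r : set ('I_(rel_ar r) -> I -> T) :=
  [set a | forall i, srel m r (a^~ i)].

Definition pow_interp : interp S (I -> T) := Interp pow_op pow_pop pow_rel.

End Powers.

Definition power (S : signature) (A : structure S) (I : Type) : structure S :=
  Structure (pow_interp A I).

Definition space_power (S : signature) (B : spaceStructure S) (I : Type) :
    spaceStructure S :=
  SpaceStructure (pow_interp (space_interp B) I : interp S {ptws I -> B}).

Definition discrete (S : signature) (M : finStructure S) : spaceStructure S :=
  SpaceStructure (fin_interp M : interp S (discrete_topology M)).

Definition topological_structure (S : signature) (B : spaceStructure S) : Prop :=
  [/\ forall g, continuous (op (flat B) g : {ptws 'I_(op_ar g) -> B} -> B),
      forall h, closed (pdom (flat B) h : set {ptws 'I_(pop_ar h) -> B}),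
      forall h, continuous
        (pop (flat B) h : (pdom (flat B) h : set {ptws 'I_(pop_ar h) -> B}) -> B)
    & forall r, closed (srel (flat B) r : set {ptws 'I_(rel_ar r) -> B})].

(* This is not the library's [zero_dimensional], which only asks that distinct
   points be separated by a clopen set. *)
Definition clopen_basis (T : topologicalType) : Prop :=
  exists F : set (set T), F `<=` clopen /\ basis F.

Section Prevarieties.
Variables (S : signature) (M : finStructure S).

Definition ISP (A : structure S) : Prop :=
  exists (I : Type) (X : set (power M I)) (subX : substructure (power M I) X),
    X !=set0 /\ exists f : A -> restr subX, iso f.

Definition IScP (B : spaceStructure S) : Prop :=
  exists (I : Type) (X : set (space_power (discrete M) I))
         (subX : substructure (flat (space_power (discrete M) I)) X),
    [/\ X !=set0, closed X & exists f : B -> space_restr subX, top_iso f].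

(* The objects of A^Bt, where A = ISP(M). *)
Definition Bt (B : spaceStructure S) : Prop :=
  [/\ topological_structure B, compact [set: B], hausdorff_space B,
      clopen_basis B & ISP (flat B)].

Definition standard : Prop := forall B : spaceStructure S, IScP B <-> Bt B.

End Prevarieties.

Section Generation.
Variables (S : signature) (B : spaceStructure S) (G : set B).

Definition closed_substructure_generated : set B :=
  smallest [set X | closed X /\ substructure (flat B) X] G.

Lemma generated_substructure :
  substructure (flat B) closed_substructure_generated.
Proof.
split=> [g a aX|h a aX] Y CY; have [[_ [opY popY]] _] := CY.
  by apply: opY => i; exact: (aX i Y CY).
by apply: popY => i; exact: (aX i Y CY).
Qed.

End Generation.

(* [iota : A -> b] is the zero-dimensional Bohr compactification of A relative
   to the class ISP(M). *)
Definition zero_dim_bohr (S : signature) (M : finStructure S) (A : structure S)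
    (b : spaceStructure S) (iota : A -> b) : Prop :=
  [/\ Bt M b,
      @embedding S A (flat b) iota,
      closed_substructure_generated (range iota) = setT
    & forall (B : spaceStructure S) (g : A -> B), Bt M B -> @hom S A (flat B) g ->
        exists! h : b -> B,
          [/\ @hom S (flat b) (flat B) h, continuous h & h \o iota = g]].

Section NaturalExtension.
Variables (S : signature) (M : finStructure S) (A : structure S).

Definition hom_set : Type := {x : A -> M | hom (x : A -> of_fin M)}.

Definition evaluation (a : A) : space_power (discrete M) hom_set :=
  fun x : hom_set => sval x a.

Definition natural_extension : spaceStructure S :=
  space_restr (generated_substructure (range evaluation)).

Definition nat_eval (a : A) : natural_extension :=
  SigSub (mem_set (@sub_smallest _ _ _ (range evaluation) (fun _ => id) _
                     (imageP evaluation (I : [set: A] a)))).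

End NaturalExtension.

Arguments natural_extension {S} M A.
Arguments evaluation {S} M A _.
Arguments nat_eval {S} M A _.

Definition coincide (S : signature) (A : structure S)
    (b c : spaceStructure S) (iota : A -> b) (e : A -> c) : Prop :=
  exists phi : b -> c, top_iso phi /\ phi \o iota = e.

(* Main.v *)
(** The evaluation a |-> (x |-> x a) embeds A in n(A), because A lies in
    ISP(M), and n(A) lies in A^Bt, because A_T is standard.  For the universal
    property let g : A -> B with B in A^Bt; by standardness we may take B to be
    a closed substructure X of a power M^I.  Every coordinate of g is then a
    homomorphism A -> M, that is, one of the indices of M^{A(A,M)}, so that g is
    the evaluation followed by the reindexing y |-> (i |-> y (g i)).  The
    preimage of X under this continuous homomorphism is a closed substructure
    containing the evaluations, hence contains n(A). *)
Require Import Defs.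
From mathcomp Require Import all_boot all_classical.
From mathcomp Require Import topology.

Set Implicit Arguments.
Unset Strict Implicit.
Unset Printing Implicit Defensive.

Local Open Scope classical_set_scope.

(** * Homomorphisms, embeddings, substructures and powers *)

Section Homomorphisms.
Variable S : signature.
Implicit Types A B C : structure S.

Lemma pop_ext (T : Type) (m : interp S T) h (a b : pdom m h) :
  set_val a = set_val b -> pop m h a = pop m h b.
Proof. by move=> /val_inj ->. Qed.

Lemma hom_id A : hom (id : A -> A).
Proof. by split=> // h a; exists a. Qed.

Lemma hom_comp A B C (f : A -> B) (g : B -> C) :
  hom f -> hom g -> hom (g \o f).
Proof.
move=> [fo fp fr] [go gp gr]; split.
- by move=> s a /=; rewrite fo go.
- move=> h a; have [b bE fE] := fp h a; have [c cE gE] := gp h b.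
  by exists c; rewrite ?cE ?bE //= fE gE.
- by move=> r a /fr /gr.
Qed.

Lemma hom_pdom A B (f : A -> B) h (a : 'I_(pop_ar h) -> A) :
  hom f -> pdom A h a -> pdom B h (f \o a).
Proof.
move=> [_ fp _] /mem_set aA; have [b /= <- _] := fp h (SigSub aA).
exact: set_valP b.
Qed.

Lemma hom_pop A B (f : A -> B) h (a : pdom A h) (b : pdom B h) :
  hom f -> set_val b = f \o set_val a -> f (pop A h a) = pop B h b.
Proof.
by move=> [_ fp _] bE; have [c cE ->] := fp h a; apply: pop_ext; rewrite cE.
Qed.

(** The witness demanded by [hom] splits into two tasks: the image tuple lies in the domain, and the
    values agree at any domain element over that tuple. *)
Lemma hom_intro A B (f : A -> B) :
  (forall g (a : 'I_(op_ar g) -> A), f (op A g a) = op B g (f \o a)) ->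
  (forall h (a : 'I_(pop_ar h) -> A), pdom A h a -> pdom B h (f \o a)) ->
  (forall h (a : pdom A h) (b : pdom B h), set_val b = f \o set_val a ->
     f (pop A h a) = pop B h b) ->
  (forall r a, srel A r a -> srel B r (f \o a)) -> hom f.
Proof.
move=> fo fd fp fr; split=> // h a.
by exists (SigSub (mem_set (fd h _ (set_valP a)))) => //; exact: fp.
Qed.

(** The condition under which a bijective homomorphism has a homomorphic inverse and an injective
    one is an embedding. *)
Definition reflecting A B (f : A -> B) : Prop :=
  (forall h a, pdom B h (f \o a) -> pdom A h a) /\
  (forall r a, srel B r (f \o a) -> srel A r a).

Lemma reflecting_comp_inv A B C (f : A -> B) (g : B -> C) :
  hom g -> reflecting (g \o f) -> reflecting f.
Proof.
move=> gH [gfp gfr]; split=> [h a fa|r a fa]; last first.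
  by have [_ _ gr] := gH; apply: gfr; exact: (gr r (f \o a)).
by apply: gfp; exact: (hom_pdom (a := f \o a) gH).
Qed.

Lemma iso_reflecting A B (f : A -> B) : iso f -> reflecting f.
Proof.
move=> [_ [f' [f'H fK _]]]; have aK n (a : 'I_n -> A) : f' \o (f \o a) = a.
  by apply/funext => i /=; rewrite fK.
split=> [h a /(hom_pdom f'H)|r a]; first by rewrite aK.
by have [_ _ f'r] := f'H => /f'r; rewrite aK.
Qed.

Lemma inverse_hom A B (f : A -> B) (f' : B -> A) :
  hom f -> reflecting f -> cancel f f' -> cancel f' f -> hom f'.
Proof.
move=> fH [fpR frR] fK f'K.
have aK n (a : 'I_n -> B) : f \o (f' \o a) = a.
  by apply/funext => i /=; rewrite f'K.
apply: hom_intro => [g a|h a aB|h a b bE|r a aB].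
- by apply: (can_inj fK); have [fo _ _] := fH; rewrite f'K fo aK.
- by apply: fpR; rewrite aK.
- by apply: (can_inj fK); rewrite f'K; apply/esym/(hom_pop fH); rewrite bE aK.
- by apply: frR; rewrite aK.
Qed.

Lemma substructure_preimage A B (f : A -> B) (X : set B) :
  hom f -> substructure B X -> substructure A (f @^-1` X).
Proof.
move=> fH [Xo Xp]; split=> [g a aX|h a aX] /=.
  by have [-> _ _] := fH; exact: Xo.
have [_ fp _] := fH; have [b bE ->] := fp h a.
by apply: Xp => i; rewrite bE; exact: aX.
Qed.

(** A tuple in the image lifts, by choice, to a tuple [c] in [X]; reflection of domains lets the
    partial operation be applied to [c] already in [A]. *)
Lemma substructure_image A B (f : A -> B) (X : set A) :
  hom f -> (forall h a, pdom B h (f \o a) -> pdom A h a) ->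
  substructure A X -> substructure B (f @` X).
Proof.
move=> fH fpR [Xo Xp]; split=> [g a aX|h a aX].
  pose c i := sval (cid2 (aX i)).
  have cX i : X (c i) by rewrite /c; case: cid2.
  have -> : a = f \o c by apply/funext => i; rewrite /= /c; case: cid2.
  by have [fo _ _] := fH; rewrite -fo; exists (op A g c) => //; exact: Xo.
pose c i := sval (cid2 (aX i)).
have cX i : X (c i) by rewrite /c; case: cid2.
have aE : set_val a = f \o c by apply/funext => i; rewrite /= /c; case: cid2.
have cA : pdom A h c by apply: fpR; rewrite -aE; exact: set_valP.
pose c' : pdom A h := SigSub (mem_set cA).
exists (pop A h c'); first exact: Xp.
exact: hom_pop.
Qed.

Lemma substructure_setT A : substructure A setT.
Proof. by []. Qed.

Lemma hom_set_val A (X : set A) (subX : substructure A X) :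
  hom (set_val : restr subX -> A).
Proof. by apply: hom_intro => // h a b bE; exact: pop_ext. Qed.

Lemma hom_restr A B (X : set B) (subX : substructure B X)
    (f : A -> restr subX) :
  hom (set_val \o f : A -> B) -> hom f.
Proof.
move=> fH; apply: hom_intro => [g a|h a|h a b bE|r a].
- by apply: val_inj; have [fo _ _] := fH; exact: fo.
- exact: (hom_pdom fH).
- by apply: val_inj; apply: (hom_pop fH); exact: (f_equal (comp set_val) bE).
- by have [_ _ fr] := fH; exact: fr.
Qed.

Lemma embedding_intro A B (f : A -> B) :
  hom f -> reflecting f -> injective f -> embedding f.
Proof.
move=> fH fR f_inj.
have subX : substructure B (range f).
  by apply: substructure_image (substructure_setT A) => //; exact: fR.1.
pose phi a : restr subX := SigSub (mem_set (imageP f (I : [set: A] a))).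
exists (range f), subX, phi; split=> //.
have phiH : hom phi by exact: hom_restr.
have phiR : reflecting phi.
  by apply: reflecting_comp_inv (hom_set_val subX) _.
pose phi' (b : restr subX) := sval (cid2 (set_valP b)).
have phi'K : cancel phi' phi.
  by move=> b; apply: val_inj; rewrite /= /phi'; case: cid2.
have phiK : cancel phi phi'.
  by move=> a; apply: f_inj; exact: (congr1 set_val (phi'K (phi a))).
by split=> //; exists phi'; split=> //; exact: inverse_hom phiH phiR phiK phi'K.
Qed.

Lemma hom_proj A (I : Type) (i : I) : hom ((fun y => y i) : power A I -> A).
Proof.
apply: hom_intro => // [h a aA|h a b bE|r a aA]; last 2 first.
- by apply: pop_ext; rewrite bE.
- exact: aA.
- exact: aA.
Qed.

Lemma hom_power A B (I : Type) (f : A -> power B I) :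
  (forall i, hom (f^~ i)) -> hom f.
Proof.
move=> fH; apply: hom_intro => [g a|h a aA i|h a b bE|r a aA i].
- by apply/funext => i; have [fo _ _] := fH i; exact: fo.
- exact: (hom_pdom (fH i)).
- apply/funext => i; apply: (hom_pop (fH i)).
  exact: (f_equal (fun u k => u k i) bE).
- by have [_ _ fr] := fH i; exact: fr.
Qed.

Lemma substructure_equalizer A B (f g : A -> B) :
  hom f -> hom g -> substructure A [set x | f x = g x].
Proof.
move=> [fo fp _] gH; split=> [s a E|h a E] /=.
  by have [go _ _] := gH; rewrite fo go; congr op; apply/funext => i; exact: E.
have [b bE ->] := fp h a; apply/esym/(hom_pop gH).
by rewrite bE; apply/funext => i; exact: E.
Qed.

End Homomorphisms.

(** * Continuity and closedness in subspaces and pointwise products *)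

Section Continuity.

Lemma continuous_initial (X : topologicalType) (Y : choiceType)
    (Z : topologicalType) (p : Y -> Z) (f : X -> initial_topology p) :
  continuous (p \o f) -> continuous f.
Proof.
move=> /continuousP cf; apply/continuousP => _ [U oU <-].
exact: cf U oU.
Qed.

Lemma continuous_set_val (X : topologicalType) (Y : set X) :
  continuous (set_val : Y -> X).
Proof. exact: initial_continuous. Qed.

(* The library's [proj_continuous] asks for an index type with decidable
   equality. *)
Lemma continuous_proj (I : Type) (T : topologicalType) (i : I) :
  continuous ((fun y => y i) : {ptws I -> T} -> T).
Proof.
move=> y; have /cvg_sup/(_ i) cy : nbhs y --> y by exact: cvg_id.
apply: cvg_trans (@initial_continuous _ _ (fun f : I -> T => f i) y).
exact: (cvg_app (fun f : I -> T => f i) cy).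
Qed.

Lemma continuous_ptws (X : topologicalType) (I : Type) (T : topologicalType)
    (f : X -> {ptws I -> T}) :
  (forall i, continuous (f^~ i)) -> continuous f.
Proof.
move=> cf x; apply/cvg_sup => i.
exact: (@continuous_initial X _ _ (fun y : I -> T => y i) f (cf i) x).
Qed.

(** At a point [x] of the closure, any neighbourhoods of [f x] and [g x] meet: near [x] there is a
    [z] with [f z = g z] in both. *)
Lemma closed_equalizer (X Y : topologicalType) (f g : X -> Y) :
  hausdorff_space Y -> continuous f -> continuous g ->
  closed [set x | f x = g x].
Proof.
move=> hY cf cg x clx; apply: hY => U V Ufx Vgx.
have W : nbhs x (f @^-1` U `&` g @^-1` V).
  by apply: filterI; [exact: cf|exact: cg].
have [z [/= Ez [Uz Vz]]] := clx _ W.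
by exists (f z); split=> //; rewrite Ez.
Qed.

Lemma closed_set_val_image (X : topologicalType) (Y : set X) (Z : set Y) :
  closed Y -> closed Z -> closed (set_val @` Z).
Proof.
move=> cY; rewrite -openC => -[U oU UE].
(* [U] is open in [X] and its trace on [Y] is the complement of [Z]. *)
have -> : set_val @` Z = Y `&` ~` U.
  apply/seteqP; split=> [_ [y Zy <-]|y [Yy nUy]].
    split; first exact: set_valP.
    by move=> Uy; have : (~` Z) y by rewrite -UE.
  exists (SigSub (mem_set Yy)) => //; apply: contrapT => nZ.
  by apply: nUy; move: nZ; rewrite -[~ _]/((~` Z) _) -UE.
by apply: closedI => //; exact: open_closedC.
Qed.

End Continuity.

(** * Closed substructures generated by a set *)

Section Generated.
Variables (S : signature) (B : spaceStructure S).
Implicit Types G : set B.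

Lemma closed_generated G : closed (closed_substructure_generated G).
Proof. by apply: closed_bigI => Y [[]]. Qed.

Lemma generated_sub G (X : set B) :
  closed X -> substructure (flat B) X -> G `<=` X ->
  closed_substructure_generated G `<=` X.
Proof. by move=> cX sX GX; exact: smallest_sub. Qed.

(** The equalizer of [f] and [g] is a closed substructure containing the generators, hence
    everything. *)
Lemma eq_on_generators G (C : spaceStructure S) (f g : B -> C) :
  closed_substructure_generated G = setT -> hausdorff_space C ->
  @hom S (flat B) (flat C) f -> @hom S (flat B) (flat C) g ->
  continuous f -> continuous g -> {in G, f =1 g} -> f = g.
Proof.
move=> GT hC fH gH cf cg fg; apply/funext => x.
have : closed_substructure_generated G x by rewrite GT.
apply: (generated_sub (X := [set x | f x = g x])).
- exact: closed_equalizer.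
- exact: (substructure_equalizer fH gH).
- by move=> y Gy; apply: fg; exact/mem_set.
Qed.

Lemma top_iso_id : @top_iso S B B id.
Proof.
split; [exact: hom_id|by move=> ?; exact: cvg_id|exists id; split=> //].
- exact: hom_id.
- by move=> ?; exact: cvg_id.
Qed.

End Generated.

(** * The natural extension and its universal property *)

Section NaturalExtensionTheory.
Variables (S : signature) (M : finStructure S) (A : structure S).

Local Notation N := (natural_extension M A).
Local Notation P := (space_power (discrete M) (hom_set M A)).
Local Notation N_sub :=
  (@generated_substructure S P (range (evaluation M A))).

Lemma hom_evaluation : @hom S A (flat P) (evaluation M A).
Proof.
by apply: (@hom_power S A M) => x; exact: (svalP x).
Qed.

Lemma hom_nat_eval : @hom S A (flat N) (nat_eval M A).
Proof.
apply: (@hom_restr S A (flat P) _ N_sub).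
exact: hom_evaluation.
Qed.

(** Generation in [P] passes to generation in [N]: as [N] is closed in [P], a closed substructure of
    [N] has as image in [P] a closed substructure. *)
Lemma closed_substructure_generated_nat_eval :
  @closed_substructure_generated S N (range (nat_eval M A)) = setT.
Proof.
apply/seteqP; split=> // y _ Y [[cY sY] GY].
have /= : (set_val @` Y) (set_val y).
  apply: (generated_sub (G := range (evaluation M A))) (set_valP y).
  - exact: (closed_set_val_image (@closed_generated S P _) cY).
  - exact: (substructure_image (hom_set_val N_sub)).
  - by move=> _ [a _ <-]; exists (nat_eval M A a) => //; apply: GY; exists a.
by move=> [z Yz /val_inj <-].
Qed.

Lemma embedding_nat_eval : ISP M A -> @embedding S A (flat N) (nat_eval M A).
Proof.
move=> [I [X [subX [_ [f fiso]]]]]; have [fH [f' [_ fK _]]] := fiso.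
have cH i : hom (fun a : A => set_val (f a) i : of_fin M).
  exact: hom_comp (hom_comp fH (hom_set_val subX)) (hom_proj M i).
(* Each coordinate of the representation [f] of [A] in a power of [M] is an index of [P]. Reading
   [y] at these indices recovers [f] from the evaluation, which thus inherits injectivity and
   reflection. *)
pose c i : hom_set M A := exist _ (fun a => set_val (f a) i) (cH i).
pose k (y : N) : power M I := fun i => set_val y (c i).
have kH : @hom S (flat N) (power M I) k.
  apply: hom_power => i.
  exact: hom_comp (hom_set_val N_sub) (@hom_proj S M _ (c i)).
have kE : k \o nat_eval M A = set_val \o f by [].
apply: embedding_intro.
- exact: hom_nat_eval.
- apply: reflecting_comp_inv kH _; rewrite kE.
  (* Domains and relations of [restr subX] are by definition preimages under [set_val], so
     [set_val \o f] reflects whatever [f] does. *)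
  exact: iso_reflecting fiso.
- move=> a b ab; apply: (can_inj fK); apply: val_inj.
  exact: (congr1 k ab).
Qed.

Lemma IScP_natural_extension : ISP M A -> IScP M N.
Proof.
move=> [I [X [subX [[x Xx] [f [_ [f' _]]]]]]].
exists (hom_set M A), _, N_sub; split.
(* Non-emptiness comes from [X]: its point [x] is pulled back to [A] and evaluated. *)
- exists (set_val (nat_eval M A (f' (SigSub (mem_set Xx))))).
  exact: set_valP.
- exact: closed_generated.
- by exists id; exact: top_iso_id.
Qed.

Lemma nat_eval_extension (B : spaceStructure S) (g : A -> B) :
  IScP M B -> @hom S A (flat B) g ->
  exists h : N -> B,
    [/\ @hom S (flat N) (flat B) h, continuous h & h \o nat_eval M A = g].
Proof.
move=> [I [X [subX [_ cX [f [fH cf [f' [f'H cf' fK _]]]]]]]] gH.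
have cH i : hom (fun a : A => set_val (f (g a)) i : of_fin M).
  exact: hom_comp (hom_comp (hom_comp gH fH) (hom_set_val subX)) (hom_proj M i).
pose c i : hom_set M A := exist _ (fun a => set_val (f (g a)) i) (cH i).
pose k (y : P) : space_power (discrete M) I := fun i => y (c i).
have kH : @hom S (flat P) (power M I) k.
  by apply: hom_power => i; exact: (@hom_proj S M _ (c i)).
have ck : continuous k.
  by apply: continuous_ptws => i; exact: continuous_proj.
have kX (y : N) : X (k (set_val y)).
  apply: (generated_sub (G := range (evaluation M A)) (X := k @^-1` X))
    (set_valP y).
  - by apply: preimage_closed => // z _; exact: ck.
  - exact: (substructure_preimage kH subX).
  (* By the choice of [c], [k] sends the evaluation at [a] to [f (g a)], a point of [X]. *)
  - by move=> _ [a _ <-]; exact: (set_valP (f (g a))).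
pose k' (y : N) : space_restr subX := SigSub (mem_set (kX y)).
have k'H : @hom S (flat N) (restr subX) k'.
  by apply: hom_restr; exact: (hom_comp (hom_set_val N_sub) kH).
have ck' : continuous k'.
  apply: continuous_initial => y.
  apply: (continuous_comp (f := set_val) (g := k)); last exact: ck.
  exact: continuous_set_val.
exists (f' \o k'); split.
- exact: (hom_comp k'H f'H).
- by move=> y; apply: continuous_comp; [exact: ck'|exact: cf'].
- apply/funext => a /=; rewrite -[RHS]fK; congr f'; exact: val_inj.
Qed.

(** Standardness serves in both directions: to place [N] in [Bt], and to represent each test object
    [B] inside a power of [M]. Uniqueness of [h] holds because [B] is Hausdorff and the evaluations
    generate [N]. *)
Lemma zero_dim_bohr_nat_eval :
  standard M -> ISP M A -> zero_dim_bohr M (nat_eval M A).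
Proof.
move=> hM hA; split.
- by apply/hM; exact: IScP_natural_extension.
- exact: embedding_nat_eval.
- exact: closed_substructure_generated_nat_eval.
- move=> B g BtB gH.
  have [h [hH ch hg]] := nat_eval_extension ((hM B).2 BtB) gH.
  exists h; split=> // h' [h'H ch' h'g].
  have [_ _ hB _ _] := BtB.
  apply: (eq_on_generators closed_substructure_generated_nat_eval) => //.
  by move=> _ /set_mem [a _ <-]; move: (congr1 (@^~ a) hg); rewrite -h'g.
Qed.

End NaturalExtensionTheory.

(** * Uniqueness of the Bohr compactification *)

Lemma zero_dim_bohr_unique (S : signature) (M : finStructure S)
    (A : structure S) (b c : spaceStructure S) (iota : A -> b) (e : A -> c) :
  zero_dim_bohr M iota -> zero_dim_bohr M e -> coincide iota e.
Proof.
have embH (d : spaceStructure S) (j : A -> d) :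
    @embedding S A (flat d) j -> @hom S A (flat d) j.
  move=> [X [subX [phi [[phiH _] /funext ->]]]].
  exact: (hom_comp phiH (hom_set_val subX)).
(* With [d] itself as test object and [j] as the map to extend, both [h] and [id] are extensions.
   This makes the two composites of the comparison maps identities. *)
have endo (d : spaceStructure S) (j : A -> d) (h : d -> d) :
    zero_dim_bohr M j -> @hom S (flat d) (flat d) h -> continuous h ->
    h \o j = j -> h = id.
  move=> [Btd jE _ ju] hH ch hj.
  have [k [_ kU]] := ju d j Btd (embH _ _ jE).
  rewrite -(kU h) //; apply: kU; split=> //; first exact: hom_id.
  by move=> ?; exact: cvg_id.
move=> Zb Zc; have [Btb bE _ bu] := Zb; have [Btc cE _ cu] := Zc.
have [f [[fH cf fE] _]] := bu c e Btc (embH _ _ cE).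
have [g [[gH cg gE] _]] := cu b iota Btb (embH _ _ bE).
have gf : g \o f = id.
  apply: (endo _ iota) => //; first exact: (hom_comp fH gH).
    by move=> x; apply: continuous_comp; [exact: cf|exact: cg].
  by rewrite -compA fE.
have fg : f \o g = id.
  apply: (endo _ e) => //; first exact: (hom_comp gH fH).
    by move=> x; apply: continuous_comp; [exact: cg|exact: cf].
  by rewrite -compA gE.
exists f; split=> //; split=> //; exists g; split=> // x.
  exact: (congr1 (@^~ x) gf).
exact: (congr1 (@^~ x) fg).
Qed.

(* The first conjunct says that b_0(A) exists; the second is about every
   representative of it, as it is determined only up to isomorphism. *)
Theorem theorem4p2 (S : signature) (M : finStructure S) (hM : standard M)
    (A : structure S) (hA : ISP M A) :
  (exists (b0 : spaceStructure S) (iota : A -> b0), zero_dim_bohr M iota) /\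
  (forall (b0 : spaceStructure S) (iota : A -> b0),
     zero_dim_bohr M iota ->
     coincide iota (nat_eval M A)).
Proof.
have Z := zero_dim_bohr_nat_eval hM hA.
split; first by exists (natural_extension M A), (nat_eval M A).
by move=> b0 iota Zb; exact: zero_dim_bohr_unique Zb Z.
Qed.
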